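(* The formal power series \[ \Phi(x,x)=\sum_{m\ge1}\sum_{n\ge1}\gcd(m,n)\,x^{m+n}\qquad\text{and}\qquad \sum_{n\ge1}\Big(\sum_{d\mid n}\frac{\phi(d)}{d}\Big)n\,x^n \] in $\mathbb{C}((x))$ are transcendental over $\mathbb{C}(x)$.
   Context: $\phi$ is Euler's totient function; $\mathbb{C}((x))$ is the field of formal Laurent series in $x$ with complex coefficients, containing the field $\mathbb{C}(x)$ of rational functions. *)

(* Defs.v *)
From mathcomp Require Import all_boot all_algebra.
From mathcomp Require Import complex reals.
Set Implicit Arguments. Unset Strict Implicit. Unset Printing Implicit Defensive.
Import GRing.Theory.
Local Open Scope ring_scope.

(* Formal power series over C := R[i] (R : realType, i.e. the complex numbers),
   represented by their coefficient sequences. *)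
Definition fps (K : Type) := nat -> K.

Section FPS.
Variable K : comRingType.

Definition fps_mul (f g : fps K) : fps K :=
  fun n => \sum_(i < n.+1) f i * g (n - i)%N.

Definition fps_one : fps K := fun n => if n == 0%N then 1 else 0.

Fixpoint fps_pow (f : fps K) (k : nat) : fps K :=
  match k with 0%N => fps_one | k'.+1 => fps_mul f (fps_pow f k') end.

Definition fps_of_poly (p : {poly K}) : fps K := fun n => p`_n.

Definition fps_eval2 (P : {poly {poly K}}) (f : fps K) : fps K :=
  fun n => \sum_(i < size P) fps_mul (fps_of_poly P`_i) (fps_pow f i) n.

(* f is algebraic over K(x): some nonzero polynomial with coefficients in
   K(x) -- equivalently (clearing denominators) in K[x] -- annihilates f. *)
Definition fps_algebraic (f : fps K) : Prop :=
  exists P : {poly {poly K}}, P != 0 /\ forall n, fps_eval2 P f n = 0.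

Definition fps_transcendental (f : fps K) : Prop := ~ fps_algebraic f.
End FPS.

(* Phi(x,x) = sum_{m,n>=1} gcd(m,n) x^(m+n): coefficient of x^N is
   sum_{m=1}^{N-1} gcd(m, N-m). *)
Definition Phi_diag (K : comRingType) : fps K :=
  fun N => \sum_(1 <= m < N) (gcdn m (N - m))%:R.

Definition totient_series (K : fieldType) : fps K :=
  fun n => if n == 0%N then 0
           else (\sum_(d <- divisors n) (totient d)%:R / d%:R) * n%:R.

(* Main.v *)
(* Write P(n) for Pillai's function, the sum of gcd(m, n) over 1 <= m <= n,
   which equals the sum of phi(d) e over de = n. The second series is
   f = sum P(n) x^n, and the first is f minus the rational function x / (1 - x)^2.
   As x = 1 - u tends to 1, L = u^2 f(1 - u) tends to infinity, but only like
   log (1/u). If Q(x, f) = 0 with Q nonzero, then W(u, L) = u^D Q(1 - u, L / u^2)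
   is, for D large, a nonzero polynomial in u and L; its part of lowest degree e
   in u dominates because L is unbounded but smaller than any power of 1/u, so
   |W(u, L)| >= c u^e, a contradiction.
   No convergence is needed: f is replaced by its truncation p at degree k^2 with
   u = 1/k. Then Q(x, p) only has terms of degree > k^2, hence is O(2^-k) up to a
   power of k at x = 1 - 1/k, which still contradicts the lower bound c k^-e. *)

Require Import Defs.
From mathcomp Require Import all_boot all_order all_algebra cyclic.
From mathcomp Require Import complex reals.
From mathcomp Require Import ring lra zify.

Set Implicit Arguments. Unset Strict Implicit. Unset Printing Implicit Defensive.
Import Order.TTheory GRing.Theory Num.Theory.
Local Open Scope ring_scope.

(** * Growth of bivariate polynomials *)

(** With q the integer part of m / (B + 1), m < (B + 1)(q + 1) <= (B + 1) 2^q. Raising to the power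
    B + 1 bounds m^(B + 1) by a constant times 2^m, and the spare factor m absorbs that constant and
    [B]. *)
Lemma leq_pow2_eventually (B : nat) :
  exists m0, forall m, (m0 <= m)%N -> (B * m ^ B <= 2 ^ m)%N.
Proof.
exists (B * B.+1 ^ B.+1)%N => m le_m.
have lt_m : (m < m %/ B.+1 * B.+1 + B.+1)%N.
  by rewrite {1}(divn_eq m B.+1) ltn_add2l ltn_mod.
set q := (m %/ B.+1)%N in lt_m.
have le_q : (q * B.+1 <= m)%N by exact: leq_divM.
have le_mq : (m ^ B.+1 <= B.+1 ^ B.+1 * 2 ^ m)%N.
  apply: (@leq_trans ((B.+1 * 2 ^ q) ^ B.+1)); last first.
    by rewrite expnMn -expnM leq_mul2l leq_pexp2l // orbT.
  rewrite leq_exp2r //; apply: ltnW; apply: leq_trans lt_m _.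
  by rewrite addnC -mulSn mulnC leq_mul2l ltn_expl ?orbT.
have pos : (0 < B.+1 ^ B.+1)%N by rewrite expn_gt0.
rewrite -(leq_pmul2l pos); apply: leq_trans le_mq.
by rewrite mulnA [X in (X * _ <= _)%N]mulnC (expnS m) leq_mul2r le_m orbT.
Qed.

Section PolynomialGrowth.
Variable R : realType.
Implicit Types (p q : {poly R}) (W : {poly {poly R}}) (u L t : R).

(** Horner induction: |p(L) L + a| >= c L - |a| >= c as soon as L >= 1 + |a| / c, so [c] survives
    each step and only the threshold grows. *)
Lemma poly_bounded_below p : p != 0 ->
  exists2 c, 0 < c & exists C : nat, forall L, C%:R <= L -> c <= `|p.[L]|.
Proof.
elim/poly_ind: p => [|p a IHp]; first by rewrite eqxx.
have [-> | p0] := eqVneq p 0.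
  rewrite mul0r add0r polyC_eq0 => a0.
  by exists `|a|; rewrite ?normr_gt0 //; exists 0%N => L _; rewrite hornerC.
move=> _; have [c c0 [C hC]] := IHp p0; exists c => //.
have b0 : 0 <= 1 + `|a| / c by rewrite addr_ge0 // divr_ge0 // ltW.
exists (C + Num.bound (1 + `|a| / c))%N => L; rewrite natrD => le_L.
have /ltW hb := archi_boundP b0; have := ler0n R C; have := hC L.
set z : R := (Num.bound _)%:R in hb le_L *.
move=> hp C0; have {}hp : c <= `|p.[L]| by apply: hp; lra.
have L1 : 1 + `|a| / c <= L by lra.
have {}L1 : c + `|a| <= c * L.
  by move: L1; rewrite -(ler_pM2l c0) mulrDr mulr1 mulrCA divff ?mulr1 // gt_eqF.
rewrite hornerMXaddC.
have L0 : 0 <= L by have := normr_ge0 a; nra.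
have := lerB_normD (p.[L] * L) a; rewrite normrM (ger0_norm L0).
have := ler_wpM2r L0 hp; lra.
Qed.

Lemma poly_bounded_above p :
  exists B : nat, forall L, 1 <= L -> `|p.[L]| <= B%:R * L ^+ B.
Proof.
elim/poly_ind: p => [|p a [B hB]].
  by exists 0%N => L _; rewrite horner0 normr0 mul0r.
pose n := Num.bound `|a|; have /ltW hn : `|a| < n%:R by exact: archi_boundP.
exists (B.+1 + n)%N => L L1; rewrite hornerMXaddC.
apply: le_trans (ler_normD _ _) _; rewrite normrM.
have L0 : 0 <= L by lra.
rewrite (ger0_norm L0) natrD mulrDl.
have hL k : (k <= B.+1 + n)%N -> L ^+ k <= L ^+ (B.+1 + n) by exact: ler_weXn2l.
apply: lerD.
  apply: le_trans (ler_wpM2r L0 (hB L L1)) _; rewrite -mulrA -exprSr.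
  by apply: ler_pM; rewrite ?exprn_ge0 ?ler0n ?ler_nat ?hL ?leq_addr.
apply: le_trans hn _; rewrite ler_peMr ?ler0n //.
exact: (hL 0%N).
Qed.

(** The outer variable of [W] is u and its coefficients are polynomials in L. One number [B] serves
    as factor and as exponent, so that bounds combine by adding their [B]. *)
Lemma bipoly_bounded_above W :
  exists B : nat, forall u L, 0 <= u -> u <= 1 -> 1 <= L ->
    `|W.[u%:P].[L]| <= B%:R * L ^+ B.
Proof.
elim/poly_ind: W => [|W p [B hB]].
  by exists 0%N => u L _ _ _; rewrite horner0 horner0 normr0 mul0r.
have [B' hB'] := poly_bounded_above p.
exists (B + B')%N => u L u0 u1 L1; rewrite hornerMXaddC hornerD hornerM hornerC.
apply: le_trans (ler_normD _ _) _; rewrite natrD mulrDl normrM (ger0_norm u0).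
have L0 : 0 <= L by lra.
have hL k : (k <= B + B')%N -> L ^+ k <= L ^+ (B + B') by exact: ler_weXn2l.
apply: lerD.
  apply: (@le_trans _ _ `|W.[u%:P].[L]|); first by rewrite ler_piMr.
  by apply: le_trans (hB _ _ u0 u1 L1) _; rewrite ler_wpM2l ?ler0n ?hL ?leq_addr.
by apply: le_trans (hB' _ L1) _; rewrite ler_wpM2l ?ler0n ?hL ?leq_addl.
Qed.

(** Factor W = u^e V with V(0) nonzero, and split V = V(0) + u Y. For large L the polynomial V(0)
    stays away from 0, while the last hypothesis, which says that L is small against a power of 1/u,
    makes u Y at most half of that lower bound. *)
Lemma bipoly_dominant W : W != 0 ->
  exists2 c, 0 < c & exists e C : nat, forall u L, 0 < u -> u <= 1 ->
    C%:R <= L -> u * (C%:R * L ^+ C) <= 1 -> c * u ^+ e <= `|W.[u%:P].[L]|.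
Proof.
move=> W0; have [e [V]] := multiplicity_XsubC W 0.
rewrite W0 subr0 /= => V0 ->.
have w0 : V.[0] != 0 by [].
have /factor_theorem [Y] : root (V - V.[0]%:P) 0.
  by rewrite /root hornerD hornerN hornerC subrr.
rewrite subr0 => /(canRL (subrK _)) ->.
have [c c0 [C1 hC1]] := poly_bounded_below w0.
have [B hB] := bipoly_bounded_above Y.
exists (c / 2); first by rewrite divr_gt0.
pose n := Num.bound (2 * B%:R / c).
have hn : 2 * B%:R / c < n%:R.
  by apply: archi_boundP; rewrite divr_ge0 ?mulr_ge0 // ltW.
have le_B : (B <= C1 + B + n + 1)%N by lia.
have le_n : (n <= C1 + B + n + 1)%N by lia.
exists e, (C1 + B + n + 1)%N => u L u0 u1 hL huL.
have -> : ((Y * 'X + V.[0]%:P) * 'X ^+ e).[u%:P].[L]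
    = (Y.[u%:P].[L] * u + V.[0].[L]) * u ^+ e.
  by rewrite !hornerE.
rewrite normrM (ger0_norm (exprn_ge0 e (ltW u0))).
apply: ler_wpM2r; first by rewrite exprn_ge0 // ltW.
move: hL; rewrite !natrD => hL.
have [hB0 hC0 hn0] : [/\ (0 : R) <= B%:R, (0 : R) <= C1%:R & (0 : R) <= n%:R] by [].
have L1 : 1 <= L by lra.
have hw : c <= `|V.[0].[L]| by apply: hC1; lra.
have hY := hB u L (ltW u0) u1 L1.
have hu : u * (n%:R * L ^+ B) <= 1.
  apply: le_trans huL; apply: ler_wpM2l; first exact: ltW.
  apply: ler_pM => //; first by rewrite exprn_ge0 // (le_trans ler01).
    by rewrite ler_nat.
  exact: ler_weXn2l.
have {}hn : 2 * B%:R <= c * n%:R.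
  by move: hn; rewrite ltr_pdivrMr // => /ltW; rewrite [c * _]mulrC.
have L0 : 0 <= u * L ^+ B.
  by rewrite mulr_ge0 ?(ltW u0) // exprn_ge0 // (le_trans ler01).
have := lerB_normD V.[0].[L] (Y.[u%:P].[L] * u).
rewrite normrM (ger0_norm (ltW u0)) addrC.
have hYu := ler_wpM2r (ltW u0) hY.
have h1 := ler_wpM2r L0 hn.
have h2 := ler_wpM2l (ltW c0) hu.
rewrite [_ + V.[0].[L]]addrC => h3.
move: hw hYu h1 h2 h3; rewrite mulr1.
set v := `|V.[0].[L]|; set y := `|Y.[_].[L]|; set w := `|_ + _|.
set z : R := L ^+ B; move: (c) z w v y (u); clear => c' z' w' v' y' u'; lra.
Qed.

(* The exponent [D] clears the denominators of [W (1 - u, L / u ^ 2)], where [L = u ^ 2 * y]. *)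
Lemma rescaled_bipoly_neq0 W : W != 0 ->
  exists2 V : {poly {poly R}}, V != 0 & exists D : nat, forall u y,
    V.[u%:P].[u ^+ 2 * y] = u ^+ D * W.[y%:P].[1 - u].
Proof.
(* [r j] is the coefficient of L^j, a polynomial in u, once denominators are cleared. So [V] has
   outer variable L, and [swapXY] restores u as the outer one. *)
move=> W0; pose r j : {poly R} := (W`_j \Po (1 - 'X)) * 'X^(2 * (size W - j)).
pose V := \poly_(j < size W) r j.
have V0 : V != 0.
  (* The top coefficient of [V] is the leading coefficient of [W] composed with 1 - X, times X^2;
     substituting a polynomial of degree one keeps it nonzero. *)
  apply/eqP => VE; have : V`_(size W).-1 = 0 by rewrite VE coef0.
  rewrite coef_poly.
  have sW : (0 < size W)%N by rewrite size_poly_gt0.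
  rewrite prednK // leqnn => /eqP; rewrite /r mulf_eq0 expf_eq0 polyX_eq0 andbF orbF.
  rewrite comp_poly2_eq0 ?lead_coef_eq0 ?(negPf W0) //.
  by rewrite -opprB size_polyN -polyC1 size_XsubC.
exists (swapXY V); first by rewrite swapXY_eq0.
exists (2 * size W)%N => u y.
have -> : (swapXY V).[u%:P].[u ^+ 2 * y] = V.[(u ^+ 2 * y)%:P].[u].
  exact: horner2_swapXY.
rewrite horner_poly (horner_coef W) !horner_sum big_distrr /=.
apply: eq_bigr => j _.
rewrite -!rmorphXn /= /r !hornerE horner_comp !hornerE exprMn.
have -> : (2 * size W = 2 * (size W - j) + 2 * j)%N by rewrite -mulnDr subnK // ltnW.
rewrite exprD -exprM /=; ring.
Qed.

(** * The l1 norm of the coefficients of a polynomial *)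

Definition l1norm p : R := \sum_(i < size p) `|p`_i|.

Lemma l1norm_widen p n : (size p <= n)%N -> l1norm p = \sum_(i < n) `|p`_i|.
Proof.
move=> le_n; rewrite /l1norm (big_ord_widen n (fun i => `|p`_i|) le_n) big_mkcond.
apply: eq_bigr => i _; case: ltnP => // /(nth_default 0) ->; exact/esym/normr0.
Qed.

Lemma l1norm_ge0 p : 0 <= l1norm p.
Proof. by apply: sumr_ge0 => i _. Qed.

Lemma l1normD p q : l1norm (p + q) <= l1norm p + l1norm q.
Proof.
have sD := size_polyD p q.
rewrite (l1norm_widen sD) (l1norm_widen (leq_maxl (size p) (size q))).
rewrite (l1norm_widen (leq_maxr (size p) (size q))) -big_split /=.
by apply: ler_sum => i _; rewrite coefD ler_normD.
Qed.

Lemma l1normMX p : l1norm (p * 'X) = l1norm p.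
Proof.
have sM : (size (p * 'X)%R <= (size p).+1)%N.
  by apply: leq_trans (size_polyMleq _ _) _; rewrite size_polyX addn2.
rewrite (l1norm_widen sM) big_ord_recl coefMX normr0 add0r.
by apply: eq_bigr => i _; rewrite coefMX.
Qed.

Lemma l1normZ a p : l1norm (a *: p) = `|a| * l1norm p.
Proof.
rewrite (l1norm_widen (size_scale_leq a p)) /l1norm big_distrr /=.
by apply: eq_bigr => i _; rewrite coefZ normrM.
Qed.

Lemma l1norm_MXaddC p a : l1norm (p * 'X + a%:P) = l1norm p + `|a|.
Proof.
have sM : (size (p * 'X + a%:P)%R <= (size p).+1)%N.
  by rewrite size_MXaddC; case: ifP.
rewrite (l1norm_widen sM) big_ord_recl addrC coefD coefMX coefC add0r.
by congr (_ + _); apply: eq_bigr => i _; rewrite coefD coefMX coefC addr0.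
Qed.

Lemma l1normM p q : l1norm (p * q) <= l1norm p * l1norm q.
Proof.
elim/poly_ind: p => [|p a IHp].
  by rewrite mul0r {1}/l1norm size_poly0 big_ord0 mulr_ge0 ?l1norm_ge0.
rewrite l1norm_MXaddC !mulrDl mul_polyC -mulrA ['X * q]mulrC mulrA.
by apply: le_trans (l1normD _ _) _; rewrite l1normMX l1normZ lerD2r.
Qed.

(** Applied to Q(x, p), this takes the place of a convergence argument: the vanishing low-order
    coefficients make the value small. *)
Lemma horner_le_l1norm p n t : 0 <= t -> t <= 1 ->
  (forall i, (i < n)%N -> p`_i = 0) -> `|p.[t]| <= t ^+ n * l1norm p.
Proof.
move=> t0 t1 p0; rewrite horner_coef /l1norm big_distrr /=.
apply: le_trans (ler_norm_sum _ _ _) _; apply: ler_sum => i _.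
rewrite normrM (ger0_norm (exprn_ge0 _ t0)) mulrC.
have [/p0 -> | le_n] := ltnP i n; first by rewrite normr0 !mulr0.
by apply: ler_wpM2r => //; apply: ler_wiXn2l.
Qed.

(** Submultiplicativity of the norm carries the bound through Horner's scheme. [B] depends on [W]
    only, hence is the same for all truncations [p]. *)
Lemma l1norm_horner_le W : exists B : nat, forall p,
  l1norm W.[p] <= B%:R * (1 + l1norm p) ^+ B.
Proof.
elim/poly_ind: W => [|W q [B hB]].
  by exists 0%N => p; rewrite horner0 mul0r /l1norm size_poly0 big_ord0.
pose n := Num.bound (l1norm q).
have /ltW hn : l1norm q < n%:R by apply: archi_boundP; apply: l1norm_ge0.
exists (B + n + 1)%N => p; rewrite hornerMXaddC.
have lp := l1norm_ge0 p; set l := l1norm p in lp *.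
have hl k k' : (k <= k')%N -> (1 + l) ^+ k <= (1 + l) ^+ k'.
  by apply: ler_weXn2l; rewrite lerDl.
have B0 : (0 : R) <= B%:R by [].
have n0 : (0 : R) <= n%:R by [].
have e0 k : 0 <= (1 + l) ^+ k by rewrite exprn_ge0 // addr_ge0.
apply: le_trans (l1normD _ _) _.
apply: (@le_trans _ _ (B%:R * (1 + l) ^+ (B + n + 1) + n%:R * (1 + l) ^+ (B + n + 1))).
  apply: lerD.
    apply: le_trans (l1normM _ _) _.
    apply: le_trans (ler_wpM2r lp (hB p)) _; rewrite -mulrA.
    apply: ler_wpM2l => //.
    apply: (@le_trans _ _ ((1 + l) ^+ B.+1)); last by apply: hl; lia.
    by rewrite exprSr ler_wpM2l // lerDr.
  by apply: le_trans hn _; rewrite ler_peMr //; apply: (hl 0%N).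
by rewrite -mulrDl -natrD ler_wpM2r // ler_nat leq_addr.
Qed.

End PolynomialGrowth.

(** * Truncations of formal power series *)

Section FormalSeries.
Variable R : realType.
Implicit Types (f : nat -> R) (P : {poly {poly R[i]}}).

Lemma fps_pow_trunc (K : comNzRingType) (f : fps K) N k n : (n < N)%N ->
  fps_pow f k n = ((\poly_(i < N) f i) ^+ k)`_n.
Proof.
elim: k n => [|k IHk] n lt_n /=; first by rewrite expr0 coef1 /fps_one; case: eqP.
rewrite exprS coefM; apply: eq_bigr => i _.
have le_i : (i <= n)%N by rewrite -ltnS.
by rewrite coef_poly (leq_ltn_trans le_i lt_n) IHk // (leq_ltn_trans (leq_subr _ _)).
Qed.

(** The coefficient of x^n in Q(x, f) involves only the coefficients of [f] up to index n. *)
Lemma fps_eval2_trunc (K : comNzRingType) (Q : {poly {poly K}}) (f : fps K) N n :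
  (n < N)%N -> fps_eval2 Q f n = (Q.[\poly_(i < N) f i])`_n.
Proof.
move=> lt_n; rewrite horner_coef coef_sum; apply: eq_bigr => k _.
rewrite coefM; apply: eq_bigr => i _.
by rewrite (fps_pow_trunc _ _ (leq_ltn_trans (leq_subr i n) lt_n)).
Qed.

Lemma fps_eval2_widen (K : comNzRingType) (Q : {poly {poly K}}) (f : fps K) M n :
  (size Q <= M)%N ->
  fps_eval2 Q f n = \sum_(i < M) fps_mul (fps_of_poly Q`_i) (fps_pow f i) n.
Proof.
move=> le_M; rewrite /fps_eval2.
rewrite (big_ord_widen M (fun i => fps_mul (fps_of_poly Q`_i) (fps_pow f i) n) le_M).
rewrite big_mkcond; apply: eq_bigr => i _; case: ltnP => // /(nth_default 0) ->.
by rewrite /fps_mul big1 // => j _; rewrite /fps_of_poly coef0 mul0r.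
Qed.

Lemma fps_pow_real f (g : fps R[i]) : (forall n, g n = (f n)%:C%C) ->
  forall k n, fps_pow g k n = (fps_pow f k n)%:C%C.
Proof.
move=> gE; elim=> [|k IHk] n /=; first by rewrite /fps_one; case: eqP.
by rewrite /fps_mul rmorph_sum; apply: eq_bigr => i _; rewrite IHk gE rmorphM.
Qed.

(** [h] will be the real or the imaginary part. Powers of a real series are real, so a real-linear
    [h] acts on the coefficients of [P] alone. *)
Lemma fps_eval2_proj (h : R[i] -> R) P f (g : fps R[i]) :
    h 0 = 0 -> {morph h : x y / x + y} ->
    (forall x y, h (x * y%:C%C) = h x * y) ->
    (forall n, g n = (f n)%:C%C) -> forall n,
  fps_eval2 (map_poly (map_poly h) P) f n = h (fps_eval2 P g n).
Proof.
move=> h0 hD hM gE n.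
rewrite ((@fps_eval2_widen _ _ _ (size P))) ?size_poly // /fps_eval2.
rewrite (big_morph h hD h0); apply: eq_bigr => k _.
rewrite /fps_mul (big_morph h hD h0); apply: eq_bigr => i _.
rewrite (fps_pow_real gE) hM /fps_of_poly; congr (_ * _).
by rewrite !coef_map_id0 // map_poly0.
Qed.

(** The real and imaginary parts of an annihilating polynomial both annihilate the real series, and
    they are not both zero. *)
Lemma fps_algebraic_real f (g : fps R[i]) : (forall n, g n = (f n)%:C%C) ->
  fps_algebraic g -> fps_algebraic f.
Proof.
move=> gE [P [P0 Pg]].
have reD : {morph @complex.Re R : x y / x + y} by move=> [? ?] [? ?].
have imD : {morph @complex.Im R : x y / x + y} by move=> [? ?] [? ?].
have reM (x : R[i]) (y : R) : complex.Re (x * y%:C%C) = complex.Re x * y.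
  by case: x => a b /=; rewrite mulr0 subr0.
have imM (x : R[i]) (y : R) : complex.Im (x * y%:C%C) = complex.Im x * y.
  by case: x => a b /=; rewrite mulr0 add0r.
have coefh (h : R[i] -> R) i j : h 0 = 0 ->
    (map_poly (map_poly h) P)`_i`_j = h P`_i`_j.
  by move=> h0; rewrite !coef_map_id0 // map_poly0.
have [Re0 | Re0] := eqVneq (map_poly (map_poly (@complex.Re R)) P) 0; last first.
  exists (map_poly (map_poly (@complex.Re R)) P); split => // n.
  by rewrite (fps_eval2_proj P _ reD reM gE) // Pg.
have [Im0 | Im0] := eqVneq (map_poly (map_poly (@complex.Im R)) P) 0; last first.
  exists (map_poly (map_poly (@complex.Im R)) P); split => // n.
  by rewrite (fps_eval2_proj P _ imD imM gE) // Pg.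
case/eqP: P0; apply/polyP => i; apply/polyP => j.
have := coefh (@complex.Re R) i j erefl; have := coefh (@complex.Im R) i j erefl.
rewrite Re0 Im0 !coef0; case: (P`_i`_j) => a b /= <- <-; exact: erefl.
Qed.

End FormalSeries.

(** * Pillai's function *)

Section PillaiFunction.

(** Both factors run over ranges, with d e = n as a filter, so that sums over n rearrange into sums
    over pairs. The value at 0 is 0. *)
Definition pillai n : nat :=
  (\sum_(1 <= d < n.+1) \sum_(1 <= e < n.+1 | d * e == n) totient d * e)%N.

Lemma sum_cofactor (T : nmodType) (F : nat -> T) n d : (0 < n)%N -> (0 < d)%N ->
  \sum_(1 <= e < n.+1 | (d * e)%N == n) F e = if (d %| n)%N then F (n %/ d)%N else 0.
Proof.
move=> n0 d0; case: ifPn => [dn | ndn]; last first.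
  rewrite big_pred0 // => e; apply/eqP => En.
  by case/negP: ndn; rewrite -En dvdn_mulr.
rewrite (eq_bigl (eq_op^~ (n %/ d)%N)) => [|e]; last first.
  by rewrite /= eqn_div // mulnC.
rewrite big_nat1_eq divn_gt0 // dvdn_leq //=.
by rewrite ltnS leq_div.
Qed.

Lemma pillai_divisors n : (0 < n)%N ->
  pillai n = (\sum_(d <- divisors n) totient d * (n %/ d))%N.
Proof.
move=> n0; rewrite /pillai -[RHS](@big_filter _ _ _ _ _ predT) /=.
have /(perm_big _) -> : perm_eq [seq d <- divisors n | predT d]
    [seq d <- index_iota 1 n.+1 | (d %| n)%N].
  apply: uniq_perm; rewrite ?filter_uniq ?divisors_uniq ?iota_uniq // => d.
  rewrite !mem_filter /= -dvdn_divisors // mem_index_iota ltnS.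
  by case dn: (d %| n)%N; rewrite // (dvdn_gt0 n0 dn) dvdn_leq.
rewrite /= big_filter [RHS]big_mkcond /= big_nat_cond [RHS]big_nat_cond.
apply: eq_bigr => d; rewrite andbT => /andP[d0 _].
by rewrite (sum_cofactor (fun e => (totient d * e)%N)).
Qed.

Lemma sum_totient_dvd_nat n g : (0 < g)%N -> (g <= n)%N ->
  (\sum_(1 <= d < n.+1 | d %| g) totient d)%N = g.
Proof.
move=> g0 le_g; rewrite -[RHS]sum_totient_dvd big_geq_mkord /=.
rewrite [RHS](big_ord_widen_cond n.+1 (fun d => d %| g)%N (fun d => totient d)) //.
apply: eq_bigl => d; case dg: (d %| g)%N => //=.
by rewrite ltnS (dvdn_gt0 g0 dg) dvdn_leq.
Qed.

(** Expand gcd(m, n) as the sum of phi(d) over its divisors d and interchange the sums: each d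
    dividing n has n / d multiples m up to n. *)
Lemma sum_gcdn n : (\sum_(1 <= m < n.+1) gcdn m n)%N = pillai n.
Proof.
transitivity (\sum_(1 <= m < n.+1) \sum_(1 <= d < n.+1 | d %| gcdn m n) totient d)%N.
  rewrite big_nat_cond [RHS]big_nat_cond; apply: eq_bigr => m.
  rewrite andbT ltnS => /andP[m0 le_m].
  by rewrite sum_totient_dvd_nat ?gcdn_gt0 ?m0 // (leq_trans _ le_m) // dvdn_leq ?dvdn_gcdl.
under eq_bigr do rewrite big_mkcond /=.
rewrite exchange_big_nat /= /pillai big_nat_cond [RHS]big_nat_cond.
apply: eq_bigr => d; rewrite andbT ltnS => /andP[d0 le_d].
rewrite (sum_cofactor (fun e => (totient d * e)%N)) ?(leq_trans d0) //.
under eq_bigr do rewrite dvdn_gcd.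
case: ifPn => dn; last by rewrite big1 // => m _; rewrite andbF.
rewrite divn_count_dvd big_distrr /=; apply: eq_bigr => m _.
by rewrite andbT; case: (d %| m)%N; rewrite (muln0, muln1).
Qed.

Lemma totient_le n : (totient n <= n)%N.
Proof.
rewrite totient_count_coprime -[X in (_ <= X)%N]subn0 -[X in (_ <= X)%N]muln1.
by rewrite -sum_nat_const_nat; apply: leq_sum => i _; apply: leq_b1.
Qed.

(** Each of the n values of d contributes either 0 or phi(d) (n / d) <= n. *)
Lemma pillai_le n : (pillai n <= n ^ 2)%N.
Proof.
rewrite /pillai -mulnn -[X in (_ <= X * _)%N](subn1 n.+1) -sum_nat_const_nat.
rewrite big_nat_cond [X in (_ <= X)%N]big_nat_cond.
apply: leq_sum => d; rewrite andbT ltnS => /andP[d0 le_d].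
rewrite (sum_cofactor (fun e => (totient d * e)%N)) ?(leq_trans d0) //.
by case: ifP => // dn; rewrite -{2}(divnK dn) mulnC leq_mul2l totient_le orbT.
Qed.

(** Both sides run over the pairs of positive integers with d e <= N. *)
Lemma sum_convolution (T : nmodType) (F : nat -> nat -> T) N :
  \sum_(1 <= n < N.+1) \sum_(1 <= d < n.+1) \sum_(1 <= e < n.+1 | (d * e)%N == n) F d e
    = \sum_(1 <= d < N.+1) \sum_(1 <= e < (N %/ d).+1) F d e.
Proof.
transitivity (\sum_(1 <= n < N.+1) \sum_(1 <= d < N.+1)
    \sum_(1 <= e < N.+1) if (d * e)%N == n then F d e else 0).
  rewrite big_nat_cond [RHS]big_nat_cond; apply: eq_bigr => n.
  rewrite andbT ltnS => /andP[n0 le_n].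
  rewrite (big_nat_widen 1 n.+1 N.+1) // big_mkcond /= big_nat_cond [RHS]big_nat_cond.
  apply: eq_bigr => d; rewrite andbT => /andP[d0 _].
  rewrite -[RHS]big_mkcond /= (big_nat_widen 1 n.+1 N.+1) //.
  case: ifPn => [dn | ndn].
    rewrite big_nat_cond [RHS]big_nat_cond; apply: eq_bigl => e.
    case e0: (0 < e)%N => //=; case: eqP => [<- | _]; rewrite ?andbF //=.
    by have -> : (e < (d * e).+1)%N by rewrite ltnS leq_pmull.
  rewrite big_nat_cond big_pred0 // => e; apply/negP => /andP[/andP[e0 _] /eqP En].
  by case/negP: ndn; rewrite -En ltnS leq_pmulr.
rewrite exchange_big_nat /= big_nat_cond [RHS]big_nat_cond.
apply: eq_bigr => d; rewrite andbT => /andP[d0 _].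
rewrite exchange_big_nat /=.
rewrite [RHS](big_nat_widen 1 _ N.+1) ?ltnS ?leq_div // [RHS]big_mkcond /=.
rewrite big_nat_cond [RHS]big_nat_cond.
apply: eq_bigr => e; rewrite andbT => /andP[e0 _].
rewrite -big_mkcond /= ltnS leq_divRL // [(e * d)%N]mulnC; case: ifPn => [le_N | gt_N].
  rewrite (eq_bigl (eq_op^~ (d * e)%N)); last by move=> n; rewrite /= eq_sym.
  by rewrite big_nat1_eq muln_gt0 d0 e0 /= ltnS le_N.
rewrite big_nat_cond big_pred0 // => n; apply/negP => /andP[/andP[_ le_n] /eqP En].
by case/negP: gt_N; rewrite En -ltnS.
Qed.

End PillaiFunction.

(** * Upper and lower bounds for sums of Pillai's function *)

Section PillaiEstimates.
Variable R : realType.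
Implicit Types (s t u z : R) (n d e N q k m : nat).

Lemma bernoulli_le u n : 0 <= u -> u <= 1 -> 1 - n%:R * u <= (1 - u) ^+ n.
Proof.
move=> u0 u1; elim: n => [|n IHn]; first by rewrite expr0; lra.
have n0 : (0 : R) <= n%:R by [].
have t0 : 0 <= 1 - u by lra.
rewrite exprS; apply: le_trans (ler_wpM2l t0 IHn); rewrite -natr1; nra.
Qed.

(** For t = 1 - 1/k one has t (k + n + 1) <= k + n, so t^n (k + n) never exceeds its value k at n =
    0; then take n = k. *)
Lemma expr_le_half k : (0 < k)%N -> (1 - k%:R^-1) ^+ k <= 2^-1 :> R.
Proof.
move=> k0; have kR : (0 : R) < k%:R by rewrite ltr0n.
have k1 : (1 : R) <= k%:R by rewrite ler1n.
set t : R := 1 - _; have tE : k%:R * t = k%:R - 1 by rewrite mulrBr mulr1 divff ?gt_eqF.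
have t0 : 0 <= t by rewrite -(pmulr_rge0 _ kR) tE subr_ge0.
have t1 : t <= 1 by rewrite gerBl invr_ge0 ler0n.
have step n : t ^+ n * (k%:R + n%:R) <= k%:R.
  elim: n => [|n IHn]; first by rewrite expr0 mul1r addr0.
  apply: le_trans IHn; rewrite exprSr -mulrA ler_wpM2l ?exprn_ge0 //.
  rewrite mulrDr [t * k%:R]mulrC tE -natr1.
  have n0 : (0 : R) <= n%:R by [].
  nra.
have := step k; rewrite -ler_pdivlMr ?addr_gt0 // => /le_trans; apply.
have -> : k%:R + k%:R = 2 * k%:R :> R by ring.
by rewrite invfM mulrCA divff ?mulr1 ?gt_eqF.
Qed.

Lemma sum_natmul_expr_le z q : 0 <= z -> z <= 1 ->
  (\sum_(1 <= e < q.+1) e%:R * z ^+ e) * (1 - z) ^+ 2 <= z.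
Proof.
move=> z0 z1.
have -> : (\sum_(1 <= e < q.+1) e%:R * z ^+ e) * (1 - z) ^+ 2
    = z - z ^+ q.+1 * (1 + q%:R * (1 - z)).
  elim: q => [|q IHq]; first by rewrite big_geq // expr1; ring.
  by rewrite big_nat_recr //= mulrDl IHq !exprS -natr1; ring.
by rewrite gerBl mulr_ge0 ?exprn_ge0 ?addr_ge0 ?mulr_ge0 ?subr_ge0.
Qed.

(** Induction by steps of two, peeling off the first and last terms: 1 + s^(2 (d + 1)) >= 2 s^(d +
    1). The extra factor [s] avoids the exponent d - 1. *)
Lemma geometric_sum_sqr_ge s d : 0 <= s ->
  d%:R * s ^+ d <= s * \sum_(i < d) s ^+ (2 * i).
Proof.
move=> s0; pose P d := d%:R * s ^+ d <= s * \sum_(i < d) s ^+ (2 * i).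
suff : P d /\ P d.+1 by case.
elim: d => [|d [Pd Pd1]]; last split=> //.
- by split; rewrite /P ?big_ord0 ?big_ord1 ?mul0r ?mulr0 //= muln0 expr0 mul1r mulr1.
rewrite /P {Pd1} big_ord_recr big_ord_recl /=.
have -> : \sum_(i < d) s ^+ (2 * bump 0 i) = s ^+ 2 * \sum_(i < d) s ^+ (2 * i).
  by rewrite big_distrr; apply: eq_bigr => i _ /=; rewrite -exprD /bump mulnDr.
move: Pd; rewrite /P; set S := (\sum_(i < d) _) => Pd.
have -> : s ^+ (2 * d.+1) = (s * s ^+ d) ^+ 2 by rewrite -exprS -exprM mulnC.
rewrite muln0 expr0 (exprS s d.+1) (exprS s d) -[d.+2]addn2 natrD.
have h1 := ler_wpM2l (mulr_ge0 s0 s0) Pd.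
have h2 := mulr_ge0 s0 (sqr_ge0 (1 - s * s ^+ d)).
move: h1 h2; set w := s ^+ d; set n : R := d%:R; lra.
Qed.

(* AM-GM on the terms [t ^+ i] and [t ^+ (d - 1 - i)] of the geometric sum
   [(1 - t ^+ d) / (1 - t)]; the square root avoids half-integral exponents. *)
Lemma sqr_onem_expr_ge t d : 0 <= t -> t <= 1 ->
  (d%:R * (1 - t)) ^+ 2 * t ^+ d <= (1 - t ^+ d) ^+ 2.
Proof.
move=> t0 t1; pose s := Num.sqrt t.
have s0 : 0 <= s by exact: sqrtr_ge0.
have tE : t = s ^+ 2 by rewrite sqr_sqrtr.
have s1 : s <= 1 by rewrite -(@ler_pXn2r _ 2) ?nnegrE // -tE expr1n.
have -> : (d%:R * (1 - t)) ^+ 2 * t ^+ d = (d%:R * s ^+ d * (1 - t)) ^+ 2.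
  by rewrite {2}tE -exprM mulnC exprM -!exprMn; congr (_ ^+ 2); ring.
have u0 : 0 <= 1 - t by rewrite subr_ge0.
rewrite ler_pXn2r ?nnegrE ?subr_ge0 ?exprn_ile1 ?mulr_ge0 ?exprn_ge0 //.
apply: le_trans (ler_wpM2r u0 (geometric_sum_sqr_ge d s0)) _.
have -> : \sum_(i < d) s ^+ (2 * i) = \sum_(i < d) t ^+ i.
  by apply: eq_bigr => i _; rewrite tE exprM.
rewrite -mulrA -[1 - t ^+ d]opprB subrX1 [in leRHS]mulrC -mulrN opprB.
by rewrite ler_piMl // mulr_ge0 // sumr_ge0 // => i _; rewrite exprn_ge0.
Qed.

Definition harmonic_sum N : R := \sum_(1 <= n < N.+1) n%:R^-1.

(** The N added terms lie between 1 / (2 N) and 1 / N. *)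
Lemma harmonic_sum_double N : (0 < N)%N ->
  2^-1 <= harmonic_sum (2 * N) - harmonic_sum N <= 1.
Proof.
move=> N0; have NR : (0 : R) < N%:R by rewrite ltr0n.
have -> : harmonic_sum (2 * N) - harmonic_sum N = \sum_(N.+1 <= n < (2 * N).+1) n%:R^-1.
  rewrite /harmonic_sum (@big_cat_nat _ _ _ N.+1) //=; first by rewrite addrAC subrr add0r.
  by rewrite ltnS leq_pmull.
have cE c : \sum_(N.+1 <= n < (2 * N).+1) c = c * N%:R :> R.
  by rewrite sumr_const_nat mul2n -addnn subSS addnK mulr_natr.
apply/andP; split.
  have <- : \sum_(N.+1 <= n < (2 * N).+1) (2 * N)%:R^-1 = 2^-1 :> R.
    by rewrite cE natrM invfM -mulrA mulVf ?mulr1 ?gt_eqF.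
  apply: ler_sum_nat => n /andP[N_n n_N]; have n0 : (0 < n)%N by apply: leq_trans N_n.
  by rewrite lef_pV2 ?posrE ?ltr0n ?ler_nat // muln_gt0.
have c1 : \sum_(N.+1 <= n < (2 * N).+1) N%:R^-1 = 1 :> R by rewrite cE mulVf ?gt_eqF.
rewrite -[leRHS]c1.
apply: ler_sum_nat => n /andP[N_n n_N]; have n0 : (0 < n)%N by apply: leq_trans N_n.
by rewrite lef_pV2 ?posrE ?ltr0n ?ler_nat // ltnW.
Qed.

Lemma harmonic_sum_pow2 m : m%:R / 2 <= harmonic_sum (2 ^ m) <= m%:R + 1.
Proof.
elim: m => [|m /andP[IHl IHu]].
  by rewrite /harmonic_sum expn0 big_nat1 invr1 mul0r add0r ler01 lexx.
have := @harmonic_sum_double (2 ^ m); rewrite expn_gt0 -expnS => /(_ isT) /andP[hl hu].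
by rewrite -natr1; apply/andP; split; lra.
Qed.

Lemma pillai_convolution (G : nat -> R) N :
  \sum_(1 <= n < N.+1) (pillai n)%:R * G n =
  \sum_(1 <= d < N.+1) \sum_(1 <= e < (N %/ d).+1) (totient d)%:R * (e%:R * G (d * e)%N).
Proof.
rewrite -sum_convolution; apply: eq_bigr => n _.
rewrite /pillai natr_sum big_distrl; apply: eq_bigr => d _.
rewrite natr_sum big_distrl; apply: eq_bigr => e /eqP <-.
by rewrite natrM mulrA.
Qed.

(** For fixed d and z = t^d, the inner sum of e z^e is at most z / (1 - z)^2 <= 1 / (d (1 - t))^2.
    As phi(d) <= d, the index d contributes at most 1/d after scaling by (1 - t)^2. *)
Lemma pillai_series_le t N : 0 <= t -> t < 1 ->
  (1 - t) ^+ 2 * (\sum_(1 <= n < N.+1) (pillai n)%:R * t ^+ n) <= harmonic_sum N.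
Proof.
move=> t0 t1; rewrite (pillai_convolution (fun n => t ^+ n)) big_distrr /=.
have u0 : 0 < 1 - t by rewrite subr_gt0.
apply: ler_sum_nat => d /andP[d0 _]; rewrite -big_distrr /=.
have dR : (0 : R) < d%:R by rewrite ltr0n.
set z := t ^+ d; have z0 : 0 <= z by exact: exprn_ge0.
have z1 : z < 1 by rewrite exprn_ilt1 // -lt0n.
have -> : \sum_(1 <= e < (N %/ d).+1) e%:R * t ^+ (d * e)
    = \sum_(1 <= e < (N %/ d).+1) e%:R * z ^+ e.
  by apply: eq_bigr => e _; rewrite exprM.
set S := (\sum_(_ <= _ < _) _).
have S0 : 0 <= S by apply: sumr_ge0 => e _; rewrite mulr_ge0 ?exprn_ge0.
have hS : S * (1 - z) ^+ 2 <= z by apply: sum_natmul_expr_le => //; apply: ltW.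
have hz : (d%:R * (1 - t)) ^+ 2 * z <= (1 - z) ^+ 2 by apply: sqr_onem_expr_ge => //; apply: ltW.
have hSd : S * (d%:R * (1 - t)) ^+ 2 <= 1.
  have [z00 | z_neq0] := eqVneq z 0.
    move: hS; rewrite z00 subr0 expr1n mulr1 => S_le0.
    have -> : S = 0 by apply/le_anti/andP.
    by rewrite mul0r.
  have zp : 0 < z by rewrite lt_def z_neq0.
  rewrite -(ler_pM2r zp) mul1r -mulrA; apply: le_trans hS.
  exact: ler_wpM2l.
rewrite -[d%:R^-1]mul1r ler_pdivlMr //.
apply: le_trans hSd.
have -> : S * (d%:R * (1 - t)) ^+ 2 = (1 - t) ^+ 2 * (d%:R * S) * d%:R by ring.
rewrite ler_pM2r // ler_pM2l ?exprn_gt0 //.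
by apply: ler_wpM2r => //; rewrite ler_nat totient_le.
Qed.

(** Write 1/n as n / n^2 and expand the numerator as the sum of phi(d) over d dividing n. This form
    can be compared with the Pillai sum for each d separately. *)
Lemma harmonic_sum_convolution N :
  harmonic_sum N = \sum_(1 <= d < N.+1) \sum_(1 <= e < (N %/ d).+1)
    (totient d)%:R * (d%:R ^- 2 * e%:R ^- 2).
Proof.
rewrite -sum_convolution; apply: eq_big_nat => n /andP[n0 _].
have nR : (n%:R : R) != 0 by rewrite pnatr_eq0 -lt0n.
transitivity ((\sum_(1 <= d < n.+1 | (d %| n)%N) totient d)%:R * n%:R ^- 2 : R).
  by rewrite sum_totient_dvd_nat // expr2 invfM mulrA divff ?mul1r.
rewrite natr_sum big_distrl big_mkcond /=; apply: eq_big_nat => d /andP[d0 _].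
rewrite -(sum_cofactor (fun _ => (totient d)%:R * n%:R ^- 2 : R)) //.
by apply: eq_bigr => e /eqP <-; rewrite natrM exprMn invfM.
Qed.

Lemma sum_inv_sqr_le q : \sum_(1 <= e < q.+1) e%:R ^- 2 <= 2 :> R.
Proof.
(* The sharper bound is what makes the induction telescope. *)
suff h n : \sum_(1 <= e < n.+2) e%:R ^- 2 <= 2 - n.+1%:R^-1 :> R.
  case: q => [|q]; first by rewrite big_geq.
  by apply: le_trans (h q) _; rewrite gerBl invr_ge0.
elim: n => [|n IHn]; first by rewrite big_nat1 expr1n invr1; lra.
rewrite big_nat_recr //=; apply: le_trans (lerD IHn (lexx _)) _.
have a0 : (0 : R) < n.+1%:R by [].
have b0 : (0 : R) < n.+2%:R by [].
rewrite -addrA lerD2l -subr_ge0.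
have -> : - n.+2%:R^-1 - (- n.+1%:R^-1 + n.+2%:R ^- 2) = (n.+1%:R * n.+2%:R ^+ 2)^-1 :> R.
  have bE : n.+2%:R = n.+1%:R + 1 :> R by rewrite natr1.
  rewrite bE in b0 *; move: (n.+1%:R : R) a0 b0 => a a0 b0.
  by field; rewrite !gt_eqF.
by rewrite invr_ge0 mulr_ge0 ?exprn_ge0.
Qed.

Lemma sum_id q : (\sum_(1 <= e < q.+1) e%:R) * 2 = q%:R * (q%:R + 1) :> R.
Proof.
elim: q => [|q IHq]; first by rewrite big_geq // !mul0r.
by rewrite big_nat_recr //= mulrDl IHq -natr1; ring.
Qed.

(** Compare for each d: with x = N / d and q its integer part, x^2 times the sum of the e^-2 is at
    most 2 x^2 <= 2 (q + 1)^2 <= 4 q (q + 1), which is 8 times the sum of e up to q. The last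
    inequality uses q >= 1. *)
Lemma pillai_sum_ge N :
  N%:R ^+ 2 * harmonic_sum N <= 8 * \sum_(1 <= n < N.+1) (pillai n)%:R.
Proof.
have -> : \sum_(1 <= n < N.+1) (pillai n)%:R = \sum_(1 <= n < N.+1) (pillai n)%:R * 1 :> R.
  by apply: eq_bigr => n _; rewrite mulr1.
rewrite (pillai_convolution (fun=> 1)) harmonic_sum_convolution !big_distrr /=.
apply: ler_sum_nat => d /andP[d0 le_d]; rewrite -!big_distrr /=.
rewrite mulrCA [leRHS]mulrCA ler_wpM2l //.
under [X in _ <= _ * X]eq_bigr do rewrite mulr1.
have dR : (0 : R) < d%:R by rewrite ltr0n.
have := sum_id (N %/ d); have := sum_inv_sqr_le (N %/ d).
have q1 : (1 : R) <= (N %/ d)%:R by rewrite ler1n divn_gt0.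
have : N%:R / d%:R <= (N %/ d)%:R + 1 :> R.
  by rewrite ler_pdivrMr // natr1 -natrM ler_nat ltnW // ltn_ceil.
have : 0 <= N%:R / d%:R :> R by rewrite divr_ge0.
rewrite mulrA -exprVn -exprMn.
move: (_ / _) (_%:R) q1 (\sum_(_ <= _ < _) _) (\sum_(_ <= _ < _) _).
move=> x q q1 E T x0 xq T2 E2.
apply: (@le_trans _ _ (x ^+ 2 * 2)); first by rewrite ler_wpM2l ?exprn_ge0.
have : x ^+ 2 <= (q + 1) ^+ 2 by rewrite ler_pXn2r ?nnegrE //; lra.
nra.
Qed.

End PillaiEstimates.

(** * Transcendence *)

Section Transcendence.
Variable R : realType.

Lemma horner_horner (Q : {poly {poly R}}) (p : {poly R}) (t : R) :
  Q.[p].[t] = Q.[(p.[t])%:P].[t].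
Proof.
elim/poly_ind: Q => [|Q q IHQ]; first by rewrite !horner0.
by rewrite !hornerMXaddC !hornerD !hornerM IHQ hornerC.
Qed.

(** With X = 2^j and u = 1 / (2 X), Bernoulli's inequality gives (1 - u)^i >= 1/2 for i <= X. These
    terms alone suffice: the 1/2 and u^2 X^2 = 1/4 make the factor 1/8. *)
Lemma truncation_ge (a : nat -> nat) (j : nat) (u := (2 ^ j.+1)%:R^-1 : R) :
    (j * 4 ^ j <= 16 * (\sum_(1 <= i < (2 ^ j).+1) a i + 4 ^ j))%N ->
  (j%:R / 16 - 1) / 8 <=
    u ^+ 2 * \sum_(1 <= i < ((2 ^ j.+1) ^ 2).+1) (a i)%:R * (1 - u) ^+ i.
Proof.
pose X := (2 ^ j)%N; rewrite -/X => a_ge.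
have X0 : (1 : R) <= X%:R by rewrite ler1n expn_gt0.
have uX : u * X%:R = 2^-1.
  by rewrite /u expnS natrM invfM -mulrA mulVf ?mulr1 // gt_eqF // (lt_le_trans ltr01).
have u0 : 0 <= u by rewrite invr_ge0.
have u1 : u <= 1 by rewrite invf_le1 ?ltr0n ?ler1n expn_gt0.
have t0 : 0 <= 1 - u by rewrite subr_ge0.
have t1 : 1 - u <= 1 by rewrite gerBl.
have tX : 2^-1 <= (1 - u) ^+ X.
  by apply: le_trans (bernoulli_le X u0 u1); rewrite mulrC uX; lra.
set y : R := (\sum_(_ <= _ < _) _); pose S : R := \sum_(1 <= i < X.+1) (a i)%:R.
have S_le : S * 2^-1 <= y.
  have le_X : (X.+1 <= ((2 ^ j.+1) ^ 2).+1)%N.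
    by rewrite ltnS -expnM leq_exp2l // (leq_trans (leqnSn j)) // leq_pmulr.
  rewrite /y (@big_cat_nat _ _ _ X.+1) //=.
  apply: (@le_trans _ _ (\sum_(1 <= i < X.+1) (a i)%:R * (1 - u) ^+ i)); last first.
    by rewrite lerDl sumr_ge0 // => i _; rewrite mulr_ge0 ?exprn_ge0.
  rewrite /S big_distrl; apply: ler_sum_nat => i /andP[_ le_i] /=.
  by apply: ler_wpM2l => //; apply: le_trans tX _; apply: ler_wiXn2l.
have S_ge : j%:R * X%:R ^+ 2 <= 16 * (S + X%:R ^+ 2).
  have X4 : (4 ^ j = X ^ 2)%N by rewrite -(expnM 2) mulnC expnM.
  by move: a_ge; rewrite X4 -(ler_nat R) !natrM natrD natrX natr_sum.
have u2X : u ^+ 2 * X%:R ^+ 2 = 4^-1.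
  by rewrite -exprMn uX exprVn; congr (_^-1); ring.
have u2 : 0 <= u ^+ 2 by rewrite exprn_ge0.
have := ler_wpM2l u2 S_le; have := ler_wpM2l u2 S_ge.
rewrite mulrCA u2X mulrCA mulrDr u2X mulrA.
move: (u ^+ 2 * S) (u ^+ 2 * y) (j%:R : R); clear => w v i; lra.
Qed.

Lemma l1norm_truncation_le (a : nat -> nat) k : (0 < k)%N ->
  (forall n, (a n <= n ^ 2)%N) ->
  1 + l1norm (\poly_(i < (k ^ 2).+1) ((a i)%:R : R)) <= (8 * k ^ 6)%:R.
Proof.
move=> k0 a_le; rewrite (l1norm_widen (size_poly _ _)).
have N0 : (0 < k ^ 2)%N by rewrite expn_gt0 k0.
have -> : (k ^ 6 = (k ^ 2) ^ 3)%N by rewrite -expnM.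
apply: (@le_trans _ _ (1 + ((k ^ 2).+1 * (k ^ 2) ^ 2)%:R)); last first.
  rewrite addrC natr1 ler_nat; move: (k ^ 2)%N N0; clear => N N0.
  have : (0 < N * N)%N by rewrite muln_gt0 N0.
  by rewrite !expnS !expn0 !muln1; nia.
rewrite lerD2l -[in leRHS](card_ord (k ^ 2).+1) -sum_nat_const natr_sum.
apply: ler_sum => i _; rewrite coef_poly ltn_ord ger0_norm // ler_nat.
by apply: leq_trans (a_le i) _; rewrite leq_exp2r // -ltnS.
Qed.

(* With [N = 2 ^ m], the second hypothesis says that the sum of the [a n] for [n <= N]
   is at least [N ^ 2 * (m / 16 - 1)], that is, of order [N ^ 2 * log N]. *)
Lemma transcendental_of_growth (a : nat -> nat) :
    (forall n, (a n <= pillai n)%N) ->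
    (forall m, (m * 4 ^ m <= 16 * (\sum_(1 <= n < (2 ^ m).+1) a n + 4 ^ m))%N) ->
  ~ fps_algebraic (fun n => (a n)%:R : R).
Proof.
move=> a_le a_ge [Q [Q0 Qa]].
have [V V0 [D VE]] := rescaled_bipoly_neq0 Q0.
have [c c0 [e [C hV]]] := bipoly_dominant V0.
have [B hB] := l1norm_horner_le Q.
pose n := Num.bound c^-1.
have /ltW hn : c^-1 < n%:R by apply: archi_boundP; rewrite invr_ge0 ltW.
(* The contradiction will come from 2^k <= n B 8^B k^(6 B + e); [A] exceeds both the constant and
   the exponent. *)
pose A := (n * B * 8 ^ B + 6 * B + e).+1.
have [mA hA] := leq_pow2_eventually A.
have [mE hE] := leq_pow2_eventually (C + C * 3 ^ C).
(* The three conditions ensure, in turn, C <= L, A k^A <= 2^k and u C L^C <= 1. *)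
have [j [jC jA jE]] : exists j,
    [/\ 16 * (8 * C + 1) <= j, mA <= j.+1 & mE <= j.+1]%N.
  by exists (16 * (8 * C + 1) + mA + mE)%N; split; lia.
pose m := j.+1.
have m_le : (2 * m + 1 <= 3 * m)%N by lia.
pose k := (2 ^ m)%N; pose u : R := k%:R^-1; pose t := 1 - u.
pose p := \poly_(i < (k ^ 2).+1) ((a i)%:R : R).
pose y := p.[t]; pose L := u ^+ 2 * y.
have k0 : (0 < k)%N by rewrite expn_gt0.
have kR : (0 : R) < k%:R by rewrite ltr0n.
have ku : k%:R * u = 1 by rewrite divff ?gt_eqF.
have u0 : 0 < u by rewrite invr_gt0.
have u_half : u <= 2^-1.
  by rewrite lef_pV2 ?posrE // ler_nat /k /m expnS leq_pmulr ?expn_gt0.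
have u1 : u <= 1 by apply: le_trans u_half _; lra.
have t0 : 0 <= t by rewrite subr_ge0.
have t1 : t < 1 by rewrite gtrBl.
have a0 : a 0%N = 0%N by apply/eqP; rewrite -leqn0 (leq_trans (a_le 0%N)) // /pillai big_geq.
have yE : y = \sum_(1 <= i < (k ^ 2).+1) (a i)%:R * t ^+ i.
  rewrite /y horner_poly -(big_mkord xpredT (fun i => (a i)%:R * t ^+ i)).
  by rewrite big_ltn // a0 mul0r add0r.
(* The truncation degree is k^2 = 2^(2 m), so the harmonic bound makes L at most logarithmic in
   1/u. *)
have L_le : L <= (2 * m)%:R + 1.
  have /andP[_] := harmonic_sum_pow2 R (2 * m); apply: le_trans.
  have -> : (2 ^ (2 * m) = k ^ 2)%N by rewrite mulnC expnM.
  apply: le_trans (pillai_series_le (k ^ 2) t0 t1).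
  rewrite /L yE /t subKr ler_pM2l ?exprn_gt0 //; apply: ler_sum => i _.
  by rewrite ler_wpM2r ?exprn_ge0 // ler_nat.
have L_ge : (j%:R / 16 - 1) / 8 <= L by rewrite /L yE; apply: truncation_ge.
have C_le : C%:R <= L.
  apply: le_trans L_ge.
  have : (16 * (8 * C + 1))%:R <= j%:R :> R by rewrite ler_nat.
  rewrite natrM natrD natrM; move: (C%:R : R) (j%:R : R); clear => x z; lra.
have L0 : 0 <= L by apply: le_trans C_le.
(* Since L <= 2 m + 1 <= 3 m, C L^C <= C 3^C m^C <= 2^m = 1/u. *)
have uCL : u * (C%:R * L ^+ C) <= 1.
  rewrite mulrC ler_pdivrMr // mul1r.
  apply: (@le_trans _ _ (C%:R * (3 * m)%:R ^+ C)).
    apply: ler_wpM2l => //; apply: lerXn2r; rewrite ?nnegrE //.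
    by apply: le_trans L_le _; rewrite natr1 -addn1 ler_nat.
  rewrite -natrX -natrM ler_nat; apply: leq_trans (hE m jE).
  rewrite expnMn mulnA leq_mul ?leq_addl // leq_pexp2l //.
  case: (C) => // C'; exact: leq_addr.
have := hV u L u0 u1 C_le uCL; rewrite VE normrM /y -/t -horner_horner.
rewrite (ger0_norm (exprn_ge0 D (ltW u0))).
(* Up to degree k^2, Q(x, p) agrees with the value of [Q] at the full series, which is zero. *)
have Qp0 i : (i < (k ^ 2).+1)%N -> Q.[p]`_i = 0.
  by move=> lt_i; rewrite -(fps_eval2_trunc Q (fun i => (a i)%:R) lt_i).
have p_le : 1 + l1norm p <= (8 * k ^ 6)%:R.
  by apply: l1norm_truncation_le => // i; apply: leq_trans (a_le i) (pillai_le i).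
have := horner_le_l1norm t0 (ltW t1) Qp0.
(* Split t^(k^2) as (t^k)^k, where t^k = (1 - 1/k)^k <= 1/2. *)
have tN : t ^+ (k ^ 2).+1 <= 2^-1 ^+ k.
  apply: (@le_trans _ _ (t ^+ (k ^ 2))); first by apply: ler_wiXn2l; rewrite // ltW.
  by rewrite -mulnn exprM ler_pXn2r ?nnegrE ?exprn_ge0 ?invr_ge0 // expr_le_half.
move=> Q_le cu_le.
have {}Q_le : `|Q.[p].[t]| <= 2^-1 ^+ k * (B%:R * (8 * k ^ 6)%:R ^+ B).
  apply: le_trans Q_le _; apply: ler_pM; rewrite ?exprn_ge0 ?l1norm_ge0 //.
  apply: le_trans (hB p) _; apply: ler_wpM2l => //.
  by apply: lerXn2r; rewrite ?nnegrE ?addr_ge0 ?l1norm_ge0.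
have {}cu_le : c * u ^+ e <= 2^-1 ^+ k * (B%:R * (8 * k ^ 6)%:R ^+ B).
  apply: le_trans cu_le _; apply: le_trans Q_le.
  by rewrite ler_piMl // exprn_ile1 // ltW.
(* Multiplying by n 2^k k^e, with c n >= 1 and k u = 1, yields an inequality between natural
   numbers. *)
have pow_le : (2 ^ k <= n * (B * (8 * k ^ 6) ^ B) * k ^ e)%N.
  rewrite -(ler_nat R) natrX !natrM natrX [(k ^ e)%:R]natrX.
  have nc : 1 <= c * n%:R by rewrite mulrC -ler_pdivrMr // mul1r.
  have k2 : (0 : R) < 2 ^+ k by rewrite exprn_gt0.
  have ke : (0 : R) < k%:R ^+ e by rewrite exprn_gt0.
  apply: le_trans (_ : c * n%:R * 2 ^+ k <= _); first by rewrite ler_peMl // ltW.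
  have n0 : (0 : R) <= n%:R * 2 ^+ k * k%:R ^+ e by rewrite !mulr_ge0 // ltW.
  have := ler_wpM2r n0 cu_le.
  have -> : c * u ^+ e * (n%:R * 2 ^+ k * k%:R ^+ e) = c * n%:R * 2 ^+ k * (k%:R * u) ^+ e.
    by rewrite exprMn; ring.
  rewrite ku expr1n mulr1 => /le_trans; apply.
  set w := B%:R * _.
  have -> : 2^-1 ^+ k * w * (n%:R * 2 ^+ k * k%:R ^+ e)
      = n%:R * w * k%:R ^+ e * (2 * 2^-1) ^+ k by rewrite exprMn; ring.
  by rewrite divff ?pnatr_eq0 // expr1n mulr1 /w natrM.
have k_ge : (mA <= k)%N.
  by apply: leq_trans jA (ltnW (ltn_expl m (isT : 1 < 2)%N)).
have := leq_trans (hA k k_ge) pow_le; rewrite leqNgt => /negP; apply.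
have -> : (n * (B * (8 * k ^ 6) ^ B) * k ^ e = n * B * 8 ^ B * k ^ (6 * B + e))%N.
  by rewrite expnMn -expnM expnD; ring.
apply: (@leq_ltn_trans (n * B * 8 ^ B * k ^ A)).
  by rewrite leq_mul2l leq_pexp2l ?orbT // /A -addnA ltnW // ltnS leq_addl.
by rewrite ltn_pmul2r ?expn_gt0 ?k0 // /A ltnS -addnA leq_addr.
Qed.

(** * Application to the totient series and the gcd series *)

Lemma pillai_sum_pow2_ge m :
  (m * 4 ^ m <= 16 * \sum_(1 <= n < (2 ^ m).+1) pillai n)%N.
Proof.
rewrite -(ler_nat R) !natrM natr_sum.
have := pillai_sum_ge R (2 ^ m); have /andP[hm _] := harmonic_sum_pow2 R m.
have -> : (4 ^ m)%:R = (2 ^ m)%:R ^+ 2 :> R.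
  by rewrite -natrX -expnM mulnC (expnM 2 2).
have x0 : 0 <= (2 ^ m)%:R ^+ 2 :> R by rewrite exprn_ge0.
have := ler_wpM2l x0 hm.
move: (_ ^+ 2) (harmonic_sum _ _) (\sum_(_ <= _ < _) _) => x H S; lra.
Qed.

Lemma transcendental_of_growth_complex (a : nat -> nat) (f : fps R[i]) :
    (forall n, (a n <= pillai n)%N) ->
    (forall m, (m * 4 ^ m <= 16 * (\sum_(1 <= n < (2 ^ m).+1) a n + 4 ^ m))%N) ->
    (forall n, f n = (a n)%:R) ->
  fps_transcendental f.
Proof.
move=> a_le a_ge fE f_alg; apply: (transcendental_of_growth a_le a_ge).
by apply: fps_algebraic_real f_alg => n; rewrite fE rmorph_nat.
Qed.

Lemma totient_series_pillai n : totient_series R[i] n = (pillai n)%:R.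
Proof.
rewrite /totient_series; case: posnP => [-> | n0]; first by rewrite /pillai big_geq.
rewrite pillai_divisors // natr_sum big_distrl /= big_seq [RHS]big_seq.
apply: eq_bigr => d; rewrite -dvdn_divisors // => dn.
have d0 : (d%:R : R[i]) != 0 by rewrite pnatr_eq0 -lt0n (dvdn_gt0 n0).
by rewrite -{1}(divnK dn) !natrM mulrA mulrAC divfK // mulrC.
Qed.

(** As gcd(m, n - m) = gcd(m, n), the sum misses only the term m = n of Pillai's sum. *)
Lemma sum_gcdn_diag n : (0 < n)%N ->
  (\sum_(1 <= m < n) gcdn m (n - m) + n)%N = pillai n.
Proof.
move=> n0; rewrite -sum_gcdn big_nat_recr //= gcdnn; congr (_ + _)%N.
apply: eq_big_nat => m /andP[_ lt_m].
by rewrite -{2}(subnK (ltnW lt_m)) gcdnDr.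
Qed.

End Transcendence.

Theorem theorem6p4 (R : realType) :
  fps_transcendental (Phi_diag R[i]) /\
  fps_transcendental (totient_series R[i]).
Proof.
split; last first.
  apply: (transcendental_of_growth_complex _ _ (totient_series_pillai R)) => // m.
  by apply: leq_trans (pillai_sum_pow2_ge R m) _; rewrite leq_mul2l leq_addr.
pose a n := (\sum_(1 <= m < n) gcdn m (n - m))%N.
apply: (@transcendental_of_growth_complex _ a) => [n | m | n].
- have [-> | n0] := posnP n; first by rewrite /a big_geq.
  by rewrite -sum_gcdn_diag // leq_addr.
- apply: leq_trans (pillai_sum_pow2_ge R m) _; rewrite leq_mul2l /=.
  (* The terms n by which [pillai n] exceeds [a n] are each at most 2^m, so over n <= 2^m they total
     at most 4^m, the slack in the growth hypothesis. *)
  have -> : (4 ^ m = \sum_(1 <= n < (2 ^ m).+1) 2 ^ m)%N.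
    by rewrite sum_nat_const_nat subn1 mulnn -expnM mulnC expnM.
  rewrite -big_split /= big_nat_cond [X in (_ <= X)%N]big_nat_cond.
  apply: leq_sum => n; rewrite andbT ltnS => /andP[n0 le_n].
  by rewrite -sum_gcdn_diag // leq_add2l.
- by rewrite /Phi_diag natr_sum.
Qed.
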